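(* Let $P$ be the condensation measure associated with the infinite discrete distribution $\nu$, and let $\kappa$ be the unique number in $(0,+\infty)$ given by $\left(\frac13\left(\frac15\right)^2\right)^{\frac{\kappa}{2+\kappa}}+\left(\frac13\left(\frac15\right)^2\right)^{\frac{\kappa}{2+\kappa}}=1$. Then $\lim_{n\to\infty}\frac{2\log n}{-\log V_n(P)}=\kappa$, i.e., the quantization dimension $D(P)$ of the measure $P$ exists and equals $\kappa$.
   Context: For $j\in\mathbb N=\{1,2,\dots\}$ let $a_j=\frac25+\frac15\cdot\frac{2^{j-1}-1}{2^{j-1}}$, and let $\nu$ be the Borel probability measure on $\mathbb R$ with $\nu(\{a_j\})=2^{-j}$ for all $j\in\mathbb N$. Let $S_1(x)=\frac15x$ and $S_2(x)=\frac15x+\frac45$ for $x\in\mathbb R$. The condensation measure $P$ associated with $\nu$ is the unique Borel probability measure on $\mathbb R$ with $P=\frac13P\circ S_1^{-1}+\frac13P\circ S_2^{-1}+\frac13\nu$. For a Borel probability measure $\mu$ on $\mathbb R$ the $n$th quantization error (of order $2$) is $V_n(\mu)=\inf\{\int\min_{a\in\alpha}(x-a)^2\,d\mu(x):\alpha\subseteq\mathbb R,\ 1\le\mathrm{card}(\alpha)\le n\}$. The quantization dimension of $\mu$ (of order 2) is $D(\mu)=\lim_{n\to\infty}\frac{2\log n}{-\log V_n(\mu)}$, when the limit exists. *)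

(* Defs.v *)
(* MathComp / MathComp-Analysis *)
From HB Require Import structures.
From mathcomp Require Import all_boot all_order all_algebra.
From mathcomp Require Import finmap all_classical all_reals all_analysis.

Set Implicit Arguments.
Unset Strict Implicit.
Unset Printing Implicit Defensive.
Import Order.TTheory GRing.Theory Num.Theory.
Import numFieldNormedType.Exports.
Local Open Scope classical_set_scope.
Local Open Scope ring_scope.

(* Meaningful for j >= 1 only. *)
Definition atom (R : realType) (j : nat) : R :=
  2 / 5 + 1 / 5 * ((2 ^+ j.-1 - 1) / 2 ^+ j.-1).

(* The masses 2^-j, j >= 1, already sum to 1, so for a probability measure
   they determine nu. *)
Definition is_discrete_distribution (R : realType)
    (nu : probability (measurableTypeR R) R) : Prop :=
  forall j : nat, (1 <= j)%N -> nu [set atom R j] = ((2 ^+ j)^-1)%:E.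

Definition S1 (R : realType) (x : R) : R := 1 / 5 * x.
Definition S2 (R : realType) (x : R) : R := 1 / 5 * x + 4 / 5.

Definition is_condensation_measure (R : realType)
    (nu P : probability (measurableTypeR R) R) : Prop :=
  forall A : set (measurableTypeR R), measurable A ->
    P A = ((1 / 3)%:E * P (@S1 R @^-1` A) + (1 / 3)%:E * P (@S2 R @^-1` A)
           + (1 / 3)%:E * nu A)%E.

(* min_(a in alpha) (x - a)^2, taken in \bar R, where +oo is neutral for min;
   it is a real number as soon as alpha is nonempty. *)
Definition min_sq_dist (R : realType) (alpha : {fset R}) (x : R) : \bar R :=
  \big[mine/+oo%E]_(a <- alpha) ((x - a) ^+ 2)%:E.

Definition quantization_error (R : realType)
    (mu : probability (measurableTypeR R) R) (n : nat) : \bar R :=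
  ereal_inf [set (\int[mu]_x min_sq_dist alpha x)%E |
             alpha in [set alpha : {fset R} | (1 <= #|` alpha| <= n)%N]].

(* "D(mu) exists and equals D".  The value of [fine] on an infinite error and
   those of the quotient where ln V_n vanishes are junk; for a compactly
   supported mu the errors are finite and tend to 0, so that, when they are
   moreover positive, junk occurs for finitely many n only. *)
Definition has_quantization_dimension (R : realType)
    (mu : probability (measurableTypeR R) R) (D : R) : Prop :=
  (2 * ln n%:R / - ln (fine (quantization_error mu n))) @[n --> \oo] --> D.

Definition kappa_equation (R : realType) (kappa : R) : Prop :=
  (1 / 3 * (1 / 5) ^+ 2) `^ (kappa / (2 + kappa))
  + (1 / 3 * (1 / 5) ^+ 2) `^ (kappa / (2 + kappa)) = 1.

(* Main.v *)
Require Import Defs.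
From HB Require Import structures.
From mathcomp Require Import all_boot all_order all_algebra.
From mathcomp Require Import finmap all_classical all_reals all_analysis.
From mathcomp Require Import measurable_realfun.
From mathcomp Require Import ring lra zify.
Set Implicit Arguments.
Unset Strict Implicit.
Unset Printing Implicit Defensive.
Import Order.TTheory GRing.Theory Num.Theory.
Import numFieldNormedType.Exports.
Local Open Scope classical_set_scope.
Local Open Scope ring_scope.

(** Write [q = 2/75] and [V_n] for the [n]th quantization error of [P].  The
    theorem follows from the two-sided estimate
      [1/18 * 1/25 * q ^ (k + 5) <= V_n <= 2 * q ^ k]
    for [2 ^ (k + 4) <= n <= 2 ^ (k + 5)], that is, [V_n] is of exact order
    [n ^ (- ln (75/2) / ln 2)]: up to bounded factors, doubling the number
    of centres divides the error by [75/2].  It gives the limit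
    [2 ln 2 / ln (75/2)], and taking logarithms in the equation of [kappa]
    gives the same number.

    Upper estimate ([good_quantizer]).  If [alpha] has [n] points, then
    [S1 alpha], [S2 alpha] and the first [m] atoms of [nu] form a set of at
    most [2 n + m] points; by the condensation identity its error for [P] is
    at most [2 * 1/3 * 1/25 = q] times that of [alpha], plus one third of the
    error of the [m] atoms for [nu].  That last error is at most the remaining
    mass [2 ^ -m], because [nu] lives in [[0, 1]].  Letting [m] grow linearly
    with the step makes it negligible with respect to [q ^ k], while the
    number of points stays of order [2 ^ k]: the tail of [nu] is so light that
    it does not influence the dimension.

    Lower estimate ([integral_min_sq_dist_ge]).  The atom [2/5] has
    mass [1/2] for [nu], hence at least [1/6] for [P], and by the condensation
    identity [S1] and [S2] keep at least a third of a mass.  So each of the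
    [2 ^ k] images of [2/5] under the compositions of length [k] of [S1] and
    [S2] has a mass at least [1/6 * 3 ^ -k].  These images are [3 * 5 ^ -k] apart, so that
    [2 ^ (k - 1)] centres are far from at least half of them, and each far
    point costs at least [25 ^ -k] times its mass. *)

(** * The squared distance to a finite set *)

Section MinSqDist.
Variable R : realType.
Implicit Types (alpha beta : {fset R}) (x : R).

Lemma min_sq_dist_le alpha a x :
  a \in alpha -> (min_sq_dist alpha x <= ((x - a) ^+ 2)%:E)%E.
Proof. by move=> aa; exact: ge_bigmin_seq. Qed.

Lemma le_min_sq_dist alpha x (c : \bar R) :
  (forall a, a \in alpha -> (c <= ((x - a) ^+ 2)%:E)%E) ->
  (c <= min_sq_dist alpha x)%E.
Proof.
move=> cle; rewrite /min_sq_dist big_seq.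
by apply: le_bigmin => //; exact: leey.
Qed.

Lemma min_sq_dist_ge0 alpha x : (0 <= min_sq_dist alpha x)%E.
Proof. by apply: le_min_sq_dist => a _; rewrite lee_fin sqr_ge0. Qed.

(** The value [+oo] is that of the empty set; keeping it as a case avoids
    nonemptiness hypotheses later on. *)
Lemma min_sq_dist_attained alpha x : min_sq_dist alpha x = +oo%E \/
  exists2 a, a \in alpha & min_sq_dist alpha x = ((x - a) ^+ 2)%:E.
Proof.
rewrite /min_sq_dist.
suff : forall s : seq R, \big[mine/+oo%E]_(a <- s) ((x - a) ^+ 2)%:E = +oo%E \/
    exists2 a, a \in s & \big[mine/+oo%E]_(a <- s) ((x - a) ^+ 2)%:E =
      ((x - a) ^+ 2)%:E by exact.
elim => [|b s ih]; first by left; rewrite big_nil.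
right; rewrite big_cons minEle; case: ifPn => [_|bs].
  by exists b; rewrite ?mem_head.
case: ih bs => [->|[a a_s ->] _]; first by rewrite leey.
by exists a; rewrite ?inE ?a_s ?orbT.
Qed.

Lemma measurable_min_sq_dist alpha :
  measurable_fun [set: measurableTypeR R]
    (min_sq_dist alpha : measurableTypeR R -> \bar R).
Proof.
rewrite /min_sq_dist; elim: (alpha : seq R) => [|b s ih].
  by under eq_fun do rewrite big_nil; exact: measurable_cst.
under eq_fun do rewrite big_cons.
apply: measurable_mine => //; apply/measurable_EFinP.
apply: measurable_funX; apply: measurable_funB => //.
Qed.

(** A similarity with squared ratio [c] scales squared distances by [c];
    enlarging the image of [alpha] can only decrease the minimum. *)
Lemma min_sq_dist_similarity (f : R -> R) (c : R) alpha beta x :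
  0 < c -> (forall y z, (f y - f z) ^+ 2 = c * (y - z) ^+ 2) ->
  (forall a, a \in alpha -> f a \in beta) ->
  (min_sq_dist beta (f x) <= c%:E * min_sq_dist alpha x)%E.
Proof.
move=> c0 fE fab; have [->|[a aa ->]] := min_sq_dist_attained alpha x.
  by rewrite gt0_muley ?lte_fin// leey.
by rewrite -EFinM -fE; exact/min_sq_dist_le/fab.
Qed.

End MinSqDist.

(** * Finite sets under a measure and the condensation identity *)

Section Measures.
Variable R : realType.
Implicit Types (nu P mu : probability (measurableTypeR R) R).

Lemma set_seq_cons (x : R) (s : seq R) : [set` x :: s] = x |` [set` s].
Proof.
apply/seteqP; split => y /=; rewrite inE; first by case/orP => [/eqP|]; tauto.
by case=> [->|->]; rewrite ?eqxx ?orbT.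
Qed.

Lemma measurable_seq (s : seq R) :
  measurable ([set` s] : set (measurableTypeR R)).
Proof.
elim: s => [|x s ih]; first by rewrite set_nil; exact: measurable0.
by rewrite set_seq_cons; apply: measurableU => //; exact: measurable_set1.
Qed.

Lemma measure_seq mu (s : seq R) : uniq s ->
  mu [set` s] = (\sum_(x <- s) mu [set x])%E.
Proof.
elim: s => [_|x s ih /= /andP[xs us]]; first by rewrite set_nil measure0 big_nil.
rewrite set_seq_cons measureU ?big_cons -?ih//.
  exact: measurable_seq.
by apply/seteqP; split => // y [/= ->]; rewrite (negbTE xs).
Qed.

Lemma measurable_S1 : measurable_fun [set: measurableTypeR R]
  (@S1 R : measurableTypeR R -> measurableTypeR R).
Proof.
exact: (@measurable_funM _ _ R setT (cst (1 / 5)) id).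
Qed.

Lemma measurable_S2 : measurable_fun [set: measurableTypeR R]
  (@S2 R : measurableTypeR R -> measurableTypeR R).
Proof.
exact: (@measurable_funD _ _ R setT (@S1 R) (cst (4 / 5)) measurable_S1).
Qed.

Let mS1 : {mfun measurableTypeR R >-> measurableTypeR R} :=
  HB.pack (@S1 R : measurableTypeR R -> measurableTypeR R)
    (isMeasurableFun.Build _ _ _ _ _ measurable_S1).

Let mS2 : {mfun measurableTypeR R >-> measurableTypeR R} :=
  HB.pack (@S2 R : measurableTypeR R -> measurableTypeR R)
    (isMeasurableFun.Build _ _ _ _ _ measurable_S2).

(** [P] is the sum of three measures, two of them pushforwards of [P], so the
    integral splits accordingly, with a change of variables in two terms. *)
Lemma condensation_integral nu P (f : measurableTypeR R -> \bar R) :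
  is_condensation_measure nu P ->
  measurable_fun [set: measurableTypeR R] f -> (forall x, (0 <= f x)%E) ->
  (\int[P]_x f x = (1 / 3)%:E * \int[P]_x f (S1 x)
    + (1 / 3)%:E * \int[P]_x f (S2 x) + (1 / 3)%:E * \int[nu]_x f x)%E.
Proof.
move=> Pcond mf f0; have c0 : (0 : R) <= 1 / 3 by lra.
pose c := NngNum c0.
rewrite (@eq_measure_integral _ _ _ _ (measure_add (measure_add
   (mscale c (distribution P mS1)) (mscale c (distribution P mS2)))
   (mscale c nu))); last first.
  move=> A mA _; rewrite /measure_add/= /msum/=.
  rewrite !big_ord_recl !big_ord0 ?adde0 /=.
  rewrite /measure_add/= /msum !big_ord_recl !big_ord0 ?adde0 /mscale/=. exact: Pcond.
rewrite !ge0_integral_measure_add// !ge0_integral_mscale//.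
by rewrite !ge0_integral_pushforward//.
Qed.

End Measures.

(** * Good quantizers *)

Section UpperBound.
Variable R : realType.
Implicit Types (nu P mu : probability (measurableTypeR R) R).

Lemma atomE (i : nat) : atom R i.+1 = 3 / 5 - 1 / 5 * (2 ^+ i)^-1.
Proof.
rewrite /atom /= mulrBl divff ?mul1r ?expf_neq0//.
by field; rewrite expf_neq0.
Qed.

Lemma atom_inj : injective (fun i => atom R i.+1).
Proof.
move=> i j; rewrite !atomE => /addrI/oppr_inj/mulfI h.
apply: (@ieexprIn R 2) => //; first by rewrite pnatr_eq1.
by apply: invr_inj; apply: h; rewrite mulf_neq0 ?invr_eq0 ?oner_eq0 ?pnatr_eq0.
Qed.

Lemma atom_itv (i : nat) : 0 <= atom R i.+1 <= 1.
Proof.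
rewrite atomE.
have : (2 ^+ i : R)^-1 <= 1 by rewrite invf_le1 ?exprn_gt0// exprn_ege1// ler1n.
have : 0 < (2 ^+ i : R)^-1 by rewrite invr_gt0 exprn_gt0.
lra.
Qed.

Definition atoms (m : nat) : seq R := [seq atom R i.+1 | i <- iota 0 m].

Lemma measure_atoms nu m : is_discrete_distribution nu ->
  nu [set` atoms m] = (1 - (2 ^+ m)^-1)%:E.
Proof.
move=> nuE; rewrite measure_seq ?(map_inj_uniq atom_inj) ?iota_uniq//.
rewrite big_map (eq_bigr (fun i => ((2 ^+ i.+1)^-1 : R)%:E)); last first.
  by move=> i _; rewrite nuE.
rewrite sumEFin; congr EFin.
elim: m => [|m ih]; first by rewrite big_nil expr0 invr1 subrr.
rewrite -[m.+1]addn1 iotaD big_cat /= big_cons big_nil ih add0n addn1 exprS.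
by field; rewrite expf_neq0.
Qed.

(** The interval has at least the mass [1 - 2 ^ -m] of the first [m] atoms, for
    every [m]. *)
Lemma measure_itv01 nu : is_discrete_distribution nu -> nu `[0%R, 1%R]%classic = 1%E.
Proof.
move=> nuE; apply/eqP; rewrite eq_le probability_le1//=.
apply/lee_addgt0Pr => e e0.
have [m _ /(_ m (leqnn m)) me] := near_infty_natSinv_expn_lt (PosNum e0).
have : (nu [set` atoms m] <= nu `[0%R, 1%R]%classic)%E.
  apply: le_measure; rewrite ?inE; [exact: measurable_seq|exact: measurable_itv|].
  by move=> x /= /mapP[i _ ->]; rewrite in_itv /= atom_itv.
rewrite (measure_atoms m nuE) => le_nu.
apply: le_trans (leeD2r e%:E le_nu).
by rewrite -EFinD lee_fin; move: me; rewrite /= div1r => me; lra.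
Qed.

(** Both [S1] and [S2] map [[0, 1]] into itself, so the mass [p] outside
    satisfies [p <= 2/3 p]. *)
Lemma condensation_measure_itv01 nu P : is_discrete_distribution nu ->
  is_condensation_measure nu P -> P `[0%R, 1%R]%classic = 1%E.
Proof.
move=> nuE PE; pose I : set (measurableTypeR R) := `[0%R, 1%R]%classic.
have mI : measurable I by exact: measurable_itv.
have mCI : measurable (~` I) by exact: measurableC.
have sub (f : measurableTypeR R -> measurableTypeR R) :
    measurable_fun setT f -> (forall x, I x -> I (f x)) ->
    (P (f @^-1` (~` I)) <= P (~` I))%E.
  move=> mf fI; apply: le_measure; rewrite ?inE//.
    by rewrite -[X in measurable X]setTI; exact: mf.
  by move=> x /= nIfx Ix; apply/nIfx/fI.
have PC0 : P (~` I) = 0%E.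
  have := PE _ mCI.
  have /= h1 := sub _ (@measurable_S1 R).
  have /= h2 := sub _ (@measurable_S2 R).
  have {}h1 : (P (@S1 R @^-1` (~` I)) <= P (~` I))%E.
    by apply: h1 => x; rewrite /I /= !in_itv /= /S1 => /andP[x0 x1]; apply/andP; split; lra.
  have {}h2 : (P (@S2 R @^-1` (~` I)) <= P (~` I))%E.
    by apply: h2 => x; rewrite /I /= !in_itv /= /S2 => /andP[x0 x1]; apply/andP; split; lra.
  rewrite (probability_setC nu mI) (measure_itv01 nuE) subee// mule0 adde0.
  have h3 := fine_ge0 (measure_ge0 P (~` I)).
  move: h1 h2.
  rewrite -[P (~` I)]fineK ?fin_num_measure//.
  rewrite -[P (_ @^-1` _)]fineK ?fin_num_measure//; last first.
    by rewrite -[X in measurable X]setTI; exact: (measurable_S1 measurableT).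
  rewrite -[P (@S2 R @^-1` _)]fineK ?fin_num_measure//; last first.
    by rewrite -[X in measurable X]setTI; exact: (measurable_S2 measurableT).
  rewrite -!EFinM -EFinD !lee_fin => h1 h2 [h4]; congr EFin; lra.
by rewrite -[LHS]/(P I) -(setCK I) probability_setC// PC0 sube0.
Qed.

(** On [[0, 1]] the squared distance to [alpha] is at most [1], and it
    vanishes on [alpha]. *)
Lemma integral_min_sq_dist_le mu (alpha : {fset R}) a :
  mu `[0%R, 1%R]%classic = 1%E -> a \in alpha -> 0 <= a <= 1 ->
  (\int[mu]_x min_sq_dist alpha x <= mu (~` [set` (alpha : seq R)]))%E.
Proof.
move=> mu1 aa a01; pose B : set (measurableTypeR R) := ~` [set` (alpha : seq R)].
have mB : measurable B by apply: measurableC; exact: measurable_seq.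
have mI : measurable (`[0%R, 1%R]%classic : set (measurableTypeR R)).
  exact: measurable_itv.
have := integral_indic mu measurableT mB; rewrite setIT => <-.
apply: ae_ge0_le_integral => //.
- by move=> x _; exact: min_sq_dist_ge0.
- exact: measurable_min_sq_dist.
- by apply/measurable_EFinP; exact: measurable_indic.
have muC0 : mu (~` `[0%R, 1%R]%classic) = 0%E.
  by rewrite probability_setC// mu1 subee.
exists (~` `[0%R, 1%R]%classic); split => //; first exact: measurableC.
apply: subsetC => x /= x01 _; rewrite indicE.
have [xa|xa] := boolP (x \in alpha).
  by apply: le_trans (min_sq_dist_le x xa) _; rewrite subrr expr0n lee_fin.
rewrite mem_set; last by move=> /=; apply/negP.
apply: le_trans (min_sq_dist_le x aa) _; rewrite lee_fin.
move: x01; rewrite in_itv /= => x01; nra.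
Qed.

(** One step of the condensation identity: quantize both copies of [P] by the
    images of [alpha], and [nu] by its first atoms.  The factor [2/75] is
    [1/3 * 1/25], the weight times the squared ratio, once for each copy. *)
Lemma condensed_quantizer nu P (alpha : {fset R}) (m : nat) :
  is_discrete_distribution nu -> is_condensation_measure nu P -> (0 < m)%N ->
  exists beta : {fset R}, [/\ (0 < #|` beta|)%N,
    (#|` beta| <= 2 * #|` alpha| + m)%N &
    (\int[P]_x min_sq_dist beta x <=
     (2 / 75)%:E * \int[P]_x min_sq_dist alpha x + (1 / 3 * (2 ^+ m)^-1)%:E)%E].
Proof.
move=> nuE PE m0.
pose s := map (@S1 R) alpha ++ map (@S2 R) alpha ++ atoms m.
pose beta := [fset x in s]%fset.
have betaE x : (x \in beta) = (x \in s) by rewrite in_fset.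
have a1 : atom R 1 \in beta.
  rewrite betaE /s !mem_cat; apply/orP; right; apply/orP; right.
  by apply/mapP; exists 0 => //; rewrite mem_iota.
have int_S (S : R -> R) : (forall y z, (S y - S z) ^+ 2 = 1 / 25 * (y - z) ^+ 2) ->
    measurable_fun setT (S : measurableTypeR R -> measurableTypeR R) ->
    (forall x, x \in alpha -> S x \in beta) ->
    (\int[P]_x min_sq_dist beta (S x) <=
     (1 / 25)%:E * \int[P]_x min_sq_dist alpha x)%E.
  move=> SE mS Sab; rewrite -ge0_integralZl ?lee_fin//; last 2 first.
  - exact: measurable_min_sq_dist.
  - by move=> x _; exact: min_sq_dist_ge0.
  apply: ge0_le_integral => //.
  - by move=> x _; exact: min_sq_dist_ge0.
  - by apply: (measurableT_comp (@measurable_min_sq_dist R beta)).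
  - by apply: measurable_funeM; exact: measurable_min_sq_dist.
  - by move=> x _; apply: min_sq_dist_similarity => //; lra.
exists beta; split.
- by rewrite cardfs_gt0; apply/fset0Pn; exists (atom R 1).
- rewrite card_fseq (leq_trans (size_undup _))// !size_cat !size_map size_iota.
  by rewrite addnA addnn mul2n.
rewrite (condensation_integral PE); last 2 first.
- exact: measurable_min_sq_dist.
- by move=> x; exact: min_sq_dist_ge0.
have h1 : (\int[P]_x min_sq_dist beta (S1 x) <=
     (1 / 25)%:E * \int[P]_x min_sq_dist alpha x)%E.
  apply: int_S; [by move=> y z; rewrite /S1; field|exact: measurable_S1|].
  by move=> x xa; rewrite betaE /s !mem_cat map_f.
have h2 : (\int[P]_x min_sq_dist beta (S2 x) <=
     (1 / 25)%:E * \int[P]_x min_sq_dist alpha x)%E.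
  apply: int_S; [by move=> y z; rewrite /S2; field|exact: measurable_S2|].
  by move=> x xa; rewrite betaE /s !mem_cat (map_f _ xa) orbT.
have h3 : (\int[nu]_x min_sq_dist beta x <= ((2 ^+ m)^-1)%:E)%E.
  apply: le_trans (integral_min_sq_dist_le (measure_itv01 nuE) a1 (atom_itv 0)) _.
  apply: (@le_trans _ _ (nu (~` [set` atoms m]))).
    apply: le_measure; rewrite ?inE; try by apply: measurableC; exact: measurable_seq.
    apply: subsetC => x /= xs; rewrite -[is_true _]/(is_true (x \in beta)).
    by rewrite betaE /s !mem_cat xs !orbT.
  rewrite probability_setC; last exact: measurable_seq.
  by rewrite (measure_atoms m nuE) -EFinB lee_fin; lra.
have c3 : (0 <= (1 / 3 : R)%:E)%E by rewrite lee_fin; lra.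
have -> : ((2 / 75 : R)%:E = (1 / 3)%:E * (1 / 25)%:E + (1 / 3)%:E * (1 / 25)%:E)%E.
  by rewrite -EFinM -EFinD; congr EFin; field.
rewrite ge0_muleDl; try by rewrite -EFinM lee_fin; lra.
rewrite [((1 / 3 / 2 ^+ m)%:E)%E]EFinM -!muleA.
by apply: leeD; [apply: leeD|]; apply: lee_wpmul2l.
Qed.

(** Iteration of the previous lemma, with [m = 7 (k + 1)] atoms at step [k].
    The exponent [7] is chosen so that [2 ^ -7 <= 1/2 * 2/75]: the term added by
    the atoms is then at most [2 ^ -(k + 1) * (2/75) ^ (k + 1)], and these terms
    add up to the factor [2 - 2 ^ -k].  The number of points obeys
    [n_(k+1) = 2 n_k + 7 (k + 1)] with [n_0 = 1], whose solution is
    [15 * 2 ^ k - 7 k - 14]. *)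
Lemma good_quantizer nu P (k : nat) :
  is_discrete_distribution nu -> is_condensation_measure nu P ->
  exists alpha : {fset R}, [/\ (0 < #|` alpha|)%N,
    (#|` alpha| + 7 * k + 14 <= 15 * 2 ^ k)%N &
    (\int[P]_x min_sq_dist alpha x <= ((2 - (2 ^+ k)^-1) * (2 / 75) ^+ k)%:E)%E].
Proof.
move=> nuE PE; elim: k => [|k [alpha [a0 ak int_a]]].
  exists [fset 0]%fset; rewrite cardfs1; split => //.
  apply: le_trans (integral_min_sq_dist_le (condensation_measure_itv01 nuE PE)
    (fset11 0) _) _; first by rewrite lexx ler01.
  apply: le_trans (probability_le1 _ _) _.
    by apply: measurableC; exact: measurable_seq.
  by rewrite !expr0 invr1 lee_fin; lra.
have [//|beta [b0 bk int_b]] := @condensed_quantizer nu P alpha (7 * k.+1) nuE PE.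
exists beta; split => //.
  by rewrite expnS; move: ak bk; lia.
apply: le_trans int_b _.
have c0 : (0 <= (2 / 75 : R)%:E)%E by rewrite lee_fin; lra.
apply: le_trans (leeD2r _ (lee_wpmul2l c0 int_a)) _.
rewrite -EFinM -EFinD lee_fin exprM !exprS expr0 !mulr1.
set u := (2 ^+ k)^-1; set v := (2 / 75) ^+ k.
rewrite !invfM -/u.
suff : (((2 * (2 * (2 * (2 * (2 * (2 * 2)))))) ^+ k)^-1 : R) <= u * v.
  move=> huv; have : 0 <= u * v by rewrite mulr_ge0 ?invr_ge0 ?exprn_ge0//; lra.
  by move=> uv; lra.
rewrite /u /v -!exprVn -exprMn; apply: lerXn2r; rewrite ?nnegrE; lra.
Qed.

End UpperBound.

(** * Separated point masses *)

Section LowerBound.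
Variable R : realType.
Implicit Types (nu P : probability (measurableTypeR R) R) (s : seq R).

(** The images of the first atom under the words of length [k] in [S1] and
    [S2].  The first atom is taken because its mass [1/2] is explicit, which
    bounds the mass of all its images from below. *)
Fixpoint word_images (k : nat) : seq R :=
  if k is k'.+1 then map (@S1 R) (word_images k') ++ map (@S2 R) (word_images k')
  else [:: atom R 1].

Lemma size_word_images k : size (word_images k) = (2 ^ k)%N.
Proof.
by elim: k => // k ih; rewrite /= size_cat !size_map ih addnn expnS mul2n.
Qed.

Lemma S1_inj : injective (@S1 R).
Proof. by move=> x y; rewrite /S1; lra. Qed.

Lemma S2_inj : injective (@S2 R).
Proof. by move=> x y; rewrite /S2; lra. Qed.

Lemma word_images_itv k x : x \in word_images k -> 0 <= x <= 1.
Proof.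
elim: k x => [x|k ih x]; first by rewrite inE => /eqP ->; exact: atom_itv.
rewrite /= mem_cat => /orP[|] /mapP[y /ih /andP[y0 y1] ->]; rewrite /S1 /S2;
  by apply/andP; split; lra.
Qed.

Lemma uniq_word_images k : uniq (word_images k).
Proof.
elim: k => // k ih; rewrite /= cat_uniq (map_inj_uniq S1_inj) (map_inj_uniq S2_inj).
rewrite ih andbT /=; apply/hasPn => _ /mapP[y /word_images_itv yk ->].
by apply/mapP => -[z /word_images_itv zk]; rewrite /S1 /S2; lra.
Qed.

(** Two images whose words agree on the first [j] letters only are
    [3/5 * 5 ^ -j] apart or more, which is smallest for [j = k - 1].  The factor
    [3] is the gap [3/5] between [S1 [0, 1]] and [S2 [0, 1]] in
    units of their length. *)
Lemma word_images_separated k x y : x \in word_images k -> y \in word_images k -> x != y ->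
  3 * 5 ^- k <= `|x - y|.
Proof.
have u1 j : (5 ^- j : R) <= 1 by rewrite invf_le1 ?exprn_gt0// exprn_ege1// ler1n.
elim: k x y => [x y|k ih x y].
  by rewrite !inE => /eqP -> /eqP ->; rewrite eqxx.
have uS : (5 ^- k.+1 : R) = 1 / 5 * 5 ^- k by rewrite exprS invfM div1r.
have := u1 k; rewrite /= !mem_cat uS => uk.
move=> /orP[] /mapP[x' x'k ->] /orP[] /mapP[y' y'k ->] xy.
- have x'y' : x' != y' by apply: contra_neq xy => ->.
  have := ih _ _ x'k y'k x'y'.
  by rewrite /S1 -mulrBr normrM ger0_norm; lra.
- have := word_images_itv x'k; have := word_images_itv y'k; rewrite /S1 /S2 => y01 x01.
  by rewrite ler0_norm; lra.
- have := word_images_itv x'k; have := word_images_itv y'k; rewrite /S1 /S2 => y01 x01.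
  by rewrite ger0_norm; lra.
- have x'y' : x' != y' by apply: contra_neq xy => ->.
  have := ih _ _ x'k y'k x'y'.
  rewrite (_ : S2 x' - S2 y' = 1 / 5 * (x' - y')); last by rewrite /S2; field.
  by rewrite normrM ger0_norm; lra.
Qed.

(** Each of [S1] and [S2] carries an atom of [P] to one with at least a third of
    its mass. *)
Lemma measure_word_images nu P k x : is_discrete_distribution nu ->
  is_condensation_measure nu P -> x \in word_images k ->
  ((1 / 6 * (1 / 3) ^+ k)%:E <= P [set x])%E.
Proof.
move=> nuE PE; elim: k x => [x|k ih x].
  rewrite inE => /eqP ->; rewrite PE// nuE// expr0.
  apply: (@le_trans _ _ ((1 / 3)%:E * ((2 ^+ 1)^-1)%:E)%E).
    by rewrite -EFinM lee_fin expr1; lra.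
  by apply: leeDr; rewrite adde_ge0// mule_ge0// lee_fin; lra.
have P0 (f : R -> R) A : (0 <= (1 / 3)%:E * P (f @^-1` A))%E.
  by rewrite mule_ge0// lee_fin; lra.
have nu0 A : (0 <= (1 / 3)%:E * nu A)%E by rewrite mule_ge0// lee_fin; lra.
have preE (f : R -> R) y : injective f -> f @^-1` [set f y] = [set y].
  by move=> finj; apply/seteqP; split => z /= => [/finj|->].
have step y : y \in word_images k ->
    ((1 / 6 * (1 / 3) ^+ k.+1)%:E <= (1 / 3)%:E * P [set y])%E.
  by move=> /ih yk; rewrite exprS mulrCA EFinM; apply: lee_wpmul2l.
rewrite /= mem_cat => /orP[] /mapP[y /step yk ->]; rewrite PE//.
  rewrite (preE _ y S1_inj).
  by apply: le_trans yk _; rewrite -addeA leeDl// adde_ge0.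
rewrite (preE _ y S2_inj).
by apply: le_trans yk _; rewrite addeAC leeDr// adde_ge0.
Qed.

(** Pigeonhole: two [2r]-separated points cannot both be at distance less
    than [r] from the same [a]. *)
Lemma size_separated s (t : seq R) (r : R) : uniq s ->
  (forall x y, x \in s -> y \in s -> x != y -> 2 * r <= `|x - y|) ->
  (forall x, x \in s -> exists2 a, a \in t & `|x - a| < r) ->
  (size s <= size t)%N.
Proof.
move=> us sep near_t.
(* The default value is harmless: every [x] in [s] has a close point in [t]. *)
pose c x := nth 0 t (find (fun a => `|x - a| < r) t).
have cP x : x \in s -> c x \in t /\ `|x - c x| < r.
  move=> /near_t[a ta xa].
  have h : has (fun a => `|x - a| < r) t by apply/hasP; exists a.
  by split; [rewrite mem_nth// -has_find|exact: (nth_find 0 h)].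
rewrite -(size_map c); apply: uniq_leq_size.
  rewrite map_inj_in_uniq// => x y xs ys cxy; apply/eqP/negPn/negP => xy.
  have := sep _ _ xs ys xy; rewrite leNgt => /negP; apply.
  have [_ xc] := cP _ xs; have [_ yc] := cP _ ys.
  rewrite (_ : x - y = (x - c x) - (y - c y)); last by rewrite cxy; ring.
  by apply: le_lt_trans (ler_normB _ _) _; lra.
by move=> _ /mapP[x /cP[] ? _ ->].
Qed.

(** With at most [2 ^ k] centres, at least half of the [2 ^ k.+1] points of
    level [k.+1] stay at distance [5 ^- k.+1] from all centres. *)
Lemma integral_min_sq_dist_ge nu P k (alpha : {fset R}) :
  is_discrete_distribution nu -> is_condensation_measure nu P ->
  (#|` alpha| <= 2 ^ k)%N ->
  ((1 / 18 * (1 / 25) * (2 / 75) ^+ k)%:E <= \int[P]_x min_sq_dist alpha x)%E.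
Proof.
move=> nuE PE ak; pose r : R := 5 ^- k.+1.
have r0 : 0 < r by rewrite invr_gt0 exprn_gt0.
pose bad x := has (fun a => `|x - a| < r) (alpha : seq R).
pose far := [seq x <- word_images k.+1 | ~~ bad x].
have size_bad : (size [seq x <- word_images k.+1 | bad x] <= 2 ^ k)%N.
  apply: leq_trans ak; apply: (@size_separated _ _ r).
  - by rewrite filter_uniq// uniq_word_images.
  - move=> x y; rewrite !mem_filter => /andP[_ xk] /andP[_ yk] xy.
    by apply: le_trans (word_images_separated xk yk xy); rewrite -/r; lra.
  - by move=> x; rewrite mem_filter => /andP[/hasP].
have size_far : (2 ^ k <= size far)%N.
  have := count_predC bad (word_images k.+1); rewrite size_word_images -!size_filter -/far.
  by rewrite expnS mul2n -addnn -(leq_add2l (2 ^ k)) => <-; rewrite leq_add2r.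
have mfar : measurable ([set` far] : set (measurableTypeR R)).
  exact: measurable_seq.
have far_dist x : x \in far -> ((r ^+ 2)%:E <= min_sq_dist alpha x)%E.
  rewrite mem_filter => /andP[/hasPn nbad _].
  apply: le_min_sq_dist => a /nbad; rewrite -leNgt lee_fin => ra.
  by rewrite -(real_normK (num_real (x - a))) lerXn2r// ?nnegrE// ltW.
have m_far : ((2 ^+ k * (1 / 6 * (1 / 3) ^+ k.+1))%:E <= P [set` far])%E.
  rewrite measure_seq; last by rewrite filter_uniq// uniq_word_images.
  apply: (@le_trans _ _ (\sum_(x <- far) (1 / 6 * (1 / 3) ^+ k.+1)%:E)%E).
    rewrite sumEFin big_const_seq count_predT iter_addr_0 -[_ *+ size far]mulr_natl.
    by rewrite lee_fin -natrX ler_pM2r ?ler_nat.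
  rewrite big_seq [leRHS]big_seq; apply: lee_sum => x.
  by rewrite mem_filter => /andP[_]; exact: measure_word_images nuE PE.
apply: (@le_trans _ _ (\int[P]_(x in [set` far]) (r ^+ 2)%:E)%E).
  rewrite integral_cst//.
  have r20 : (0 <= (r ^+ 2)%:E)%E by rewrite lee_fin sqr_ge0.
  apply: le_trans (lee_wpmul2l r20 m_far); rewrite -EFinM lee_fin.
  rewrite /r -exprVn exprAC !exprS expr0 mulr1.
  rewrite (_ : 2 / 75 = 5^-1 * 5^-1 * 2 * (1 / 3)); last by field.
  by rewrite !exprMn; lra.
apply: (@le_trans _ _ (\int[P]_(x in [set` far]) min_sq_dist alpha x)%E).
  apply: ge0_le_integral => //.
  - by move=> x _; rewrite lee_fin sqr_ge0.
  - exact: measurable_funTS (@measurable_min_sq_dist R alpha).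
apply: ge0_subset_integral => //.
- exact: measurable_min_sq_dist.
- by move=> x _; exact: min_sq_dist_ge0.
Qed.

End LowerBound.

(** * Asymptotics *)

(** A logarithm known up to a bounded error determines the limit, since
    [ln n] tends to infinity: [- ln (V n) / ln n] is squeezed to [c]. *)
Lemma cvg_two_ln_div (R : realType) (V : nat -> R) (c C : R) : 0 < c ->
  (\forall n \near \oo, `|- ln (V n) - c * ln n%:R| <= C) ->
  (2 * ln n%:R / - ln (V n)) @[n --> \oo] --> 2 / c.
Proof.
move=> c0 VC.
have lny : (ln (n%:R : R)) @[n --> \oo] --> +oo.
  apply/cvgryPge => A; near=> n.
  rewrite -[A]expRK ler_ln ?posrE ?expR_gt0//; last first.
    by rewrite ltr0n; near: n; exact: nbhs_infty_gt.
  by near: n; exact: nbhs_infty_ger.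
have ln_pos : \forall n \near \oo, 0 < ln (n%:R : R).
  by move/cvgryPgt : lny; exact.
have lnV0 : (ln (n%:R : R))^-1 @[n --> \oo] --> 0 by apply/gtr0_cvgV0.
have Ccvg (b : R) : c + b * (ln (n%:R : R))^-1 @[n --> \oo] --> c.
  rewrite -[X in _ --> X]addr0; apply: cvgD; first exact: cvg_cst.
  by rewrite -(mulr0 b); apply: cvgMr.
have ratio : (- ln (V n) / ln (n%:R : R)) @[n --> \oo] --> c.
  apply: (@squeeze_cvgr _ _ _ _ (fun n => c + (- C) * (ln (n%:R : R))^-1)
    (fun n => c + C * (ln (n%:R : R))^-1)) => //.
  near=> n; have n0 : 0 < ln (n%:R : R) by near: n.
  have : `|- ln (V n) - c * ln n%:R| <= C by near: n.
  rewrite ler_norml => /andP[h1 h2].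
  by rewrite ler_pdivlMr// ler_pdivrMr// !mulrDl !mulfVK ?gt_eqF//; lra.
rewrite (_ : (fun n => _) = (fun n => 2 * (- ln (V n) / ln (n%:R : R))^-1)); last first.
  by apply/funext => n; rewrite invf_div mulrA.
by apply: cvgMr; apply: cvgV => //; rewrite gt_eqF.
Unshelve. all: by end_near. Qed.

Section Dimension.
Variable R : realType.
Implicit Types (nu P : probability (measurableTypeR R) R).

(** The shift by [4] absorbs the factor [15 <= 2 ^ 4] in the size of the good
    quantizers. *)
Lemma quantization_error_bounds nu P k n :
  is_discrete_distribution nu -> is_condensation_measure nu P ->
  (2 ^ (k + 4) <= n <= 2 ^ (k + 5))%N ->
  ((1 / 18 * (1 / 25) * (2 / 75) ^+ (k + 5))%:E <= quantization_error P n
    <= (2 * (2 / 75) ^+ k)%:E)%E.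
Proof.
move=> nuE PE /andP[kn nk]; apply/andP; split.
  apply/ereal_infP => _ [alpha /= /andP[_ an] <-].
  exact: integral_min_sq_dist_ge nuE PE (leq_trans an nk).
have [alpha [a0 ak int_a]] := good_quantizer k nuE PE.
apply: ge_ereal_inf; exists (\int[P]_x min_sq_dist alpha x)%E.
  exists alpha => //=; rewrite a0/=; apply: leq_trans kn.
  apply: (@leq_trans (15 * 2 ^ k)); last by rewrite expnD mulnC leq_mul.
  by apply: leq_trans ak; rewrite -addnA leq_addr.
apply: le_trans int_a _; rewrite lee_fin ler_pM2r; last first.
  by rewrite exprn_gt0//; lra.
by rewrite gerBl invr_ge0 exprn_ge0.
Qed.

(** Both [ln n / ln 2] and [- ln V_n / ln (75/2)] differ from [k] by a bounded
    amount when [n] is between [2 ^ (k + 4)] and [2 ^ (k + 5)]. *)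
Lemma ln_quantization_error nu P :
  is_discrete_distribution nu -> is_condensation_measure nu P ->
  exists C, \forall n \near \oo,
    `|- ln (fine (quantization_error P n)) - ln (75 / 2) / ln 2 * ln n%:R| <= C.
Proof.
move=> nuE PE; pose c1 : R := 1 / 18 * (1 / 25).
exists (5 * ln (75 / 2) + ln 2 - ln c1).
have L0 : 0 < ln (75 / 2 : R) by rewrite ln_gt0//; lra.
have l0 : 0 < ln (2 : R) by rewrite ln_gt0//; lra.
(* Writing [k + 4] for the binary logarithm of [n] requires [2 ^ 4 <= n]. *)
exists 16%N => // n /= n16.
pose k := (trunc_log 2 n - 4)%N.
have n0 : (0 < n)%N by apply: leq_trans n16.
have tE : trunc_log 2 n = (k + 4)%N.
  by rewrite subnK// -[4%N]/(trunc_log 2 16) leq_trunc_log.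
have /= := @trunc_log_bounds 2 n isT n0; rewrite tE => /andP[kn nk].
have /andP[V1 V2] : ((1 / 18 * (1 / 25) * (2 / 75) ^+ (k + 5))%:E <= quantization_error P n
    <= (2 * (2 / 75) ^+ k)%:E)%E.
  by apply: (quantization_error_bounds nuE PE); rewrite kn ltnW//= addnS.
have Vfin : quantization_error P n \is a fin_num.
  by rewrite fin_real// (lt_le_trans _ V1) ?ltNyr// (le_lt_trans V2) ?ltry.
move: V1 V2; set v := fine _; have -> : quantization_error P n = v%:E by rewrite fineK.
rewrite !lee_fin -/c1 => V1 V2.
have q0 j : 0 < (2 / 75 : R) ^+ j by rewrite exprn_gt0//; lra.
have c10 : 0 < c1 by rewrite /c1; lra.
have b0 : 0 < c1 * (2 / 75) ^+ (k + 5) by rewrite mulr_gt0.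
have b1 : 0 < 2 * (2 / 75) ^+ k :> R by rewrite mulr_gt0.
have v0 : 0 < v by exact: lt_le_trans V1.
have lnq : ln (2 / 75 : R) = - ln (75 / 2).
  by rewrite -[2 / 75]invrK lnV ?posrE ?invf_div//; lra.
have lnqX j : ln ((2 / 75) ^+ j) = - (j%:R * ln (75 / 2)) :> R.
  by rewrite lnXn ?lnq ?mulNrn ?(mulr_natl (ln (75 / 2)))//; lra.
have W1 : ln c1 - (k%:R + 5) * ln (75 / 2) <= ln v.
  apply: (@le_trans _ _ (ln (c1 * (2 / 75) ^+ (k + 5)))); last first.
    by rewrite ler_ln ?posrE.
  by rewrite [leRHS]lnM ?posrE// lnqX natrD.
have W2 : ln v <= ln 2 - k%:R * ln (75 / 2).
  apply: (@le_trans _ _ (ln (2 * (2 / 75) ^+ k))); first by rewrite ler_ln ?posrE.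
  by rewrite [leLHS]lnM ?posrE// lnqX.
have X1 : (k%:R + 4) * ln 2 <= ln (n%:R : R).
  rewrite -natrD mulr_natl -lnXn// -natrX ler_ln ?posrE ?ltr0n ?expn_gt0//.
  by rewrite ler_nat.
have X2 : ln (n%:R : R) <= (k%:R + 5) * ln 2.
  rewrite -natrD mulr_natl -lnXn// -natrX ler_ln ?posrE ?ltr0n ?expn_gt0//.
  by rewrite ler_nat ltnW// addnS.
set c := ln (75 / 2) / ln 2.
have c0 : 0 < c by rewrite divr_gt0.
have cl : c * ln 2 = ln (75 / 2) by rewrite divfK// gt_eqF.
have Y1 : (k%:R + 4) * ln (75 / 2) <= c * ln n%:R.
  by rewrite -cl mulrCA ler_pM2l.
have Y2 : c * ln n%:R <= (k%:R + 5) * ln (75 / 2).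
  by rewrite -cl [leRHS]mulrCA ler_pM2l.
have lc1 : ln c1 <= 0 by rewrite ln_le0// /c1; lra.
by rewrite ler_norml; apply/andP; split; lra.
Qed.

(** The equation says [75 `^ (k / (2 + k)) = 2]; it is linear in [k] after
    taking logarithms. *)
Lemma kappa_equationE (k : R) : 0 < k ->
  kappa_equation k <-> k = 2 / (ln (75 / 2) / ln 2).
Proof.
move=> k0; pose a : R := 1 / 3 * (1 / 5) ^+ 2.
have l0 : 0 < ln (2 : R) by rewrite ln_gt0//; lra.
have L0 : 0 < ln (75 / 2 : R) by rewrite ln_gt0//; lra.
have a0 : 0 < a by rewrite /a; lra.
have lna : ln a = - (ln (75 / 2) + ln 2).
  rewrite -lnM ?posrE; try lra.
  rewrite -lnV ?posrE; last lra.
  by congr ln; rewrite /a; field.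
have p0 : 0 < a `^ (k / (2 + k)) by rewrite powR_gt0.
have -> : kappa_equation k <-> ln (a `^ (k / (2 + k))) = - ln 2.
  rewrite /kappa_equation -/a -lnV ?posrE//; split => [h|].
    by congr ln; lra.
  by move/ln_inj; rewrite ?posrE invr_gt0 => ->//; lra.
rewrite ln_powR lna; split => [h|->].
  have : k * ln (75 / 2) = 2 * ln 2.
    have k2 : 2 + k != 0 by lra.
    by move: h => /(congr1 (fun x => x * (2 + k))); rewrite mulrAC divfK//; lra.
  by move=> e; rewrite invf_div mulrA -e mulfK// gt_eqF.
by field; rewrite !gt_eqF//; lra.
Qed.

End Dimension.

Theorem theorem3p8p1 (R : realType)
    (nu P : probability (measurableTypeR R) R)
    (nu_distr : is_discrete_distribution nu)
    (P_cond : is_condensation_measure nu P) :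
  exists kappa : R,
    unique (fun k : R => 0 < k /\ kappa_equation k) kappa /\
    has_quantization_dimension P kappa.
Proof.
have c0 : 0 < ln (75 / 2 : R) / ln 2 by rewrite divr_gt0// ln_gt0//; lra.
have kappa0 : 0 < 2 / (ln (75 / 2 : R) / ln 2) by rewrite divr_gt0.
exists (2 / (ln (75 / 2) / ln 2)); split.
  split; first by split => //; exact/kappa_equationE.
  by move=> k [k0 /(kappa_equationE k0)].
have [C VC] := ln_quantization_error nu_distr P_cond.
exact: cvg_two_ln_div c0 VC.
Qed.
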